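(* For all $z,w\in\mathbb{C}$ with $\Re z>1$ and $\Re w>1$, $$\sum_{m,n=1}^{\infty}\frac{s(m,n)}{m^z n^w}=\frac{\zeta^2(z)\,\zeta^2(w)\,\zeta(z+w-1)}{\zeta(z+w)},$$ $$\sum_{m,n=1}^{\infty}\frac{c(m,n)}{m^z n^w}=\frac{\zeta^2(z)\,\zeta^2(w)\,\zeta(z+w-1)}{\zeta^2(z+w)}.$$
   Context: For positive integers $m,n$, $s(m,n)$ denotes the total number of subgroups of the group $\mathbb{Z}_m\times\mathbb{Z}_n$, and $c(m,n)$ denotes the number of its cyclic subgroups, where $\mathbb{Z}_m$ is the additive group of residue classes modulo $m$. $\zeta$ is the Riemann zeta function. *)

(* Defs.v *)
From mathcomp Require Import all_boot all_order all_algebra all_fingroup.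
From mathcomp Require Import cyclic.
From mathcomp Require Import complex.
From mathcomp Require Import all_classical all_reals all_analysis.
From mathcomp Require summability.

Set Implicit Arguments.
Unset Strict Implicit.
Unset Printing Implicit Defensive.

Import Order.TTheory GRing.Theory Num.Theory.
Import numFieldNormedType.Exports.

Local Open Scope classical_set_scope.
Local Open Scope ring_scope.
Local Open Scope complex_scope.

(* R[i] packed as a numClosedFieldType: limits need this packing, because the
   normed topology of the modulus is found on abstract number fields, not on the
   bare type R[i]. *)
Definition CC (R : realType) : numClosedFieldType := R[i].

(* For m > 0 the type 'I_m.-1.+1 is 'I_m, and its group law is addition modulo
   m, including for m = 1 ('Z_1 would be the integers modulo 2). The value at
   m = 0 or n = 0 is irrelevant. *)
Definition ZxZ (m n : nat) : finGroupType :=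
  ('I_m.-1.+1 * 'I_n.-1.+1)%type.

Definition nb_subgroups (m n : nat) : nat := #|{: {group ZxZ m n}}|.

Definition nb_cyclic_subgroups (m n : nat) : nat :=
  #|[pred H : {group ZxZ m n} | cyclic H]|.

Definition expC (R : realType) (z : R[i]) : R[i] :=
  (expR (complex.Re z) * cos (complex.Im z))
    +i* (expR (complex.Re z) * sin (complex.Im z)).

(* n ^ z = exp (z log n) with the real logarithm, for n > 0. *)
Definition npowC (R : realType) (n : nat) (z : R[i]) : R[i] :=
  expC (z * (ln n%:R)%:C).

(* The Riemann zeta function on the half-plane Re s > 1, where it is the sum of
   its Dirichlet series; unspecified elsewhere. *)
Definition zeta (R : realType) (s : R[i]) : R[i] :=
  limn (series (fun k : nat => (npowC k.+1 s)^-1 : CC R)).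

(* The double series of f m n over m, n >= 1 converges to l unconditionally
   (equivalently, absolutely): its partial sums over finite sets of pairs tend
   to l along the directed set of finite sets. *)
Definition double_series_cvg (R : realType) (f : nat -> nat -> R[i])
    (l : R[i]) : Prop :=
  summability.partial_sum (fun p : nat * nat => f p.1.+1 p.2.+1 : CC R)
    @ summability.totally --> (l : CC R).

(* Main.v *)
(* Counting: a subgroup H of Z_m x Z_n is determined by its Hermite normal form
   (a, e, t), where (a, 0) generates the intersection of H with the first factor
   and (t, e) generates H modulo that intersection.  The constraints are a | m,
   e | n, t < a and a | (n / e) t, and exactly gcd(a, n / e) values of t are
   admissible, so s(m, n) is the sum of gcd(a, b) over a | m and b | n.  Giving
   each element x the weight 1 / phi(order x), every cyclic subgroup gets total
   weight 1; since phi(a) phi(b) = phi(gcd(a, b)) phi(lcm(a, b)), c(m, n) is the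
   sum of phi(gcd(a, b)) over a | m and b | n.

   Summation: with s = z + w, the identity sum_{d | n} phi(d) = n gives
   zeta(s) D(s) = zeta(s - 1) for the Dirichlet series D of phi.  Applied to
   n = gcd(a, b), it gives the double series of gcd(a, b) as
   D(s) zeta(z) zeta(w), and also as zeta(s) times the double series of
   phi(gcd(a, b)).  A last convolution with the constant 1 multiplies both by
   zeta(z) zeta(w).  All this takes place among absolutely summable families,
   where convolutions are products regrouped along finite fibers, and dividing is
   legitimate because |zeta(s) - 1| < 1 for Re s > 2. *)

Require Import Defs.
From mathcomp Require Import all_boot all_order all_algebra all_fingroup finmap.
From mathcomp Require Import cyclic complex.
From mathcomp Require Import all_classical all_reals all_analysis.
From mathcomp Require Import summability.
From mathcomp Require Import ring lra zify.

Import Order.TTheory GRing.Theory Num.Theory.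
Import numFieldNormedType.Exports.
Import Normc.

Set Implicit Arguments.
Unset Strict Implicit.
Unset Printing Implicit Defensive.

(** * Counting subgroups *)

Section counting.
Import GroupScope.
Local Open Scope nat_scope.

(** With [g = gcdn a k] and [c = a %/ g], coprimality turns [a %| k * t] into [c %| t]; the
    multiples of [c] below [a = c * g] are [g] in number. *)
Lemma count_dvdn_mul (a k : nat) : 0 < a ->
  \sum_(t <- iota 0 a | a %| k * t) 1 = gcdn a k.
Proof.
move=> a0; set g := gcdn a k.
have g0 : 0 < g by rewrite gcdn_gt0 a0.
pose c := a %/ g.
have ac : a = c * g by rewrite divnK // dvdn_gcdl.
have c0 : 0 < c by move: a0; rewrite ac muln_gt0 => /andP[].
have kg : k = (k %/ g) * g by rewrite divnK // dvdn_gcdr.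
have cop : coprime c (k %/ g).
  by rewrite /coprime -(eqn_pmul2r g0) muln_gcdl -ac -kg mul1n.
have dE t : (a %| k * t) = (c %| t).
  by rewrite [in LHS]ac kg mulnAC dvdn_pmul2r // Gauss_dvdr.
rewrite -big_filter sum1_size -[RHS](size_iota 0) -[RHS](size_map (muln c)).
apply/perm_size/uniq_perm.
- by rewrite filter_uniq ?iota_uniq.
- by rewrite map_inj_uniq ?iota_uniq // => x y /eqP; rewrite eqn_pmul2l // => /eqP.
move=> t; rewrite mem_filter dE mem_iota add0n /=.
apply/andP/mapP => [[/dvdnP[q ->] qa]|[q]].
  exists q; last by rewrite mulnC.
  by rewrite mem_iota add0n /=; move: qa; rewrite ac mulnC ltn_pmul2l.
by rewrite mem_iota add0n /= => qg ->; rewrite dvdn_mulr // ac ltn_pmul2l.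
Qed.

Lemma big_divisors_inv (R : Type) (idx : R) (op : Monoid.com_law idx)
    (n : nat) (F : nat -> R) :
  0 < n -> \big[op/idx]_(d <- divisors n) F (n %/ d) =
           \big[op/idx]_(d <- divisors n) F d.
Proof.
move=> n0; rewrite -(big_map (divn n) xpredT); apply/perm_big/uniq_perm.
- rewrite map_inj_in_uniq ?divisors_uniq // => d e.
  rewrite -!dvdn_divisors // => dn en /(congr1 (divn n)).
  by rewrite !divnA // !mulKn.
- exact: divisors_uniq.
move=> d; apply/mapP/idP => [[e]|].
  by rewrite -!dvdn_divisors // => en ->; apply: dvdn_div.
rewrite -dvdn_divisors // => dn; exists (n %/ d).
  by rewrite -dvdn_divisors // dvdn_div.
by rewrite divnA // mulKn.
Qed.

(** * Subgroups of Z_M x Z_N and their Hermite normal forms *)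

Section lattice.
Variables m n : nat.
Let M := m.+1.
Let N := n.+1.
Notation gT := (ZxZ M N).

(** Elements are handled through arbitrary natural representatives, so that divisibility and
    Euclidean division apply to coordinates. *)
Definition pt (x y : nat) : gT := (inZp x, inZp y).

Lemma ptE (p : gT) : p = pt p.1 p.2.
Proof. by case: p => x y; rewrite /pt /= !valZpK. Qed.

Lemma pt_eq x y x' y' : x = x' %[mod M] -> y = y' %[mod N] -> pt x y = pt x' y'.
Proof. by move=> ex ey; congr (_, _); apply: val_inj. Qed.

Lemma ptM x y x' y' : (pt x y * pt x' y')%g = pt (x + x') (y + y').
Proof.
rewrite -[LHS]/((inZp x * inZp x')%g, (inZp y * inZp y')%g).
by congr (_, _); apply: val_inj; rewrite /= modnDm.
Qed.

Lemma pt1 : pt 0 0 = 1%g.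
Proof. by congr (_, _); apply: val_inj. Qed.

Lemma ptX x y k : (pt x y ^+ k)%g = pt (k * x) (k * y).
Proof. by elim: k => [|k IHk]; rewrite ?pt1 // expgS IHk ptM. Qed.

Lemma pt_div x y x' y' : exists z1 z2 : nat, [/\ (pt x y = pt z1 z2 * pt x' y')%g,
  z1 + x' = x %[mod M] & z2 + y' = y %[mod N]].
Proof.
pose z := (pt x y * (pt x' y')^-1)%g; exists z.1, z.2.
have E : (pt x y = pt z.1 z.2 * pt x' y')%g by rewrite -ptE mulgKV.
have [/esym xE /esym yE] : pt x y = pt (z.1 + x') (z.2 + y') by rewrite E ptM.
by split.
Qed.

(** The span of (a, 0) and (t, e), given by a membership test: if the second coordinate is q e, the
    first must be q t modulo a. *)
Definition hnf_sub (a e t : nat) : {set gT} :=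
  [set p : gT | (e %| p.2) && (p.1 == (p.2 %/ e) * t %[mod a])].

Definition hnf (u : nat * nat * nat) :=
  let: (a, e, t) := u in [&& a %| M, e %| N & a %| (N %/ e) * t].

(** The test does not depend on the representatives: changing [y] by a multiple of [N] changes
    [y %/ e] by a multiple of [N %/ e], which [a %| N %/ e * t] absorbs. *)
Lemma mem_hnf_sub a e t x y : hnf (a, e, t) ->
  (pt x y \in hnf_sub a e t) = (e %| y) && (x == (y %/ e) * t %[mod a]).
Proof.
move=> /and3P[aM eN aNt]; rewrite inE /= modn_dvdm //.
have -> : (e %| y %% N) = (e %| y).
  by rewrite [in RHS](divn_eq y N) dvdn_addr // dvdn_mull.
case ey : (e %| y) => //=; congr (_ == _).
rewrite [in RHS](divn_eq y N) divnDl ?dvdn_mull // -muln_divA // mulnDl.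
by have /dvdnP[k E] := aNt; rewrite -mulnA E mulnA modnMDl.
Qed.

Lemma hnf_sub_group_set a e t : hnf (a, e, t) -> group_set (hnf_sub a e t).
Proof.
move=> h; apply/group_setP; split.
  by rewrite -pt1 mem_hnf_sub // dvdn0 div0n mul0n /=.
move=> p q; rewrite (ptE p) (ptE q) ptM !mem_hnf_sub //.
move=> /andP[d1 /eqP e1] /andP[d2 /eqP e2]; rewrite dvdn_add //= divnDl // mulnDl.
by rewrite -modnDm e1 e2 modnDm.
Qed.

Lemma hnf_sub_inj a e t a' e' t' : hnf (a, e, t) -> hnf (a', e', t') ->
  t < a -> t' < a' -> hnf_sub a e t = hnf_sub a' e' t' ->
  (a, e, t) = (a', e', t').
Proof.
(* Testing the generators (b, 0) and (s, f) of one span in the other gives both divisibilities; by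
   symmetry [a] and [e] are determined, and testing (t, e) then determines [t]. *)
have half b f s b' f' s' : hnf (b, f, s) -> hnf (b', f', s') ->
    hnf_sub b f s = hnf_sub b' f' s' -> 0 < f -> (b' %| b) && (f' %| f).
  move=> h h' E f0; have : pt b 0 \in hnf_sub b f s.
    by rewrite mem_hnf_sub // dvdn0 div0n mul0n modnn mod0n eqxx.
  rewrite E mem_hnf_sub // dvdn0 div0n mul0n mod0n => /= bb.
  have -> : b' %| b by exact: bb.
  have : pt s f \in hnf_sub b f s.
    by rewrite mem_hnf_sub // dvdnn divnn f0 mul1n eqxx.
  by rewrite E mem_hnf_sub // => /andP[].
move=> h h' ta ta' E.
have e0 : 0 < e by case/and3P: h => _ eN _; apply: dvdn_gt0 eN.
have e0' : 0 < e' by case/and3P: h' => _ eN _; apply: dvdn_gt0 eN.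
have /andP[aa ee] := half _ _ _ _ _ _ h h' E e0.
have /andP[aa' ee'] := half _ _ _ _ _ _ h' h (esym E) e0'.
have eE : e = e' by apply/eqP; rewrite eqn_dvd ee ee'.
have aE : a = a' by apply/eqP; rewrite eqn_dvd aa aa'.
subst e' a'; have : pt t e \in hnf_sub a e t.
  by rewrite mem_hnf_sub // dvdnn divnn e0 mul1n eqxx.
rewrite E mem_hnf_sub // dvdnn divnn e0 mul1n !modn_small // => /eqP ->.
by [].
Qed.

(** Take the least [a > 0] with (a, 0) in [H] and the least [e > 0] occurring as a second coordinate
    in [H]. Minimality kills the remainders of Euclidean divisions by [a] and by [e]. *)
Lemma hnf_sub_surj (H : {group gT}) :
  exists a e t, [/\ hnf (a, e, t), t < a & H = hnf_sub a e t :> {set gT}].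
Proof.
have ptM0 : pt M 0 = 1%g by rewrite -pt1; apply: pt_eq; rewrite // modnn.
have ptN0 : pt 0 N = 1%g by rewrite -pt1; apply: pt_eq; rewrite // modnn.
have exa : exists a, (0 < a) && (pt a 0 \in H).
  by exists M; rewrite ptM0 group1.
have exe : exists e, (0 < e) && [exists x : 'I_M, pt x e \in H].
  exists N; apply/existsP; exists ord0.
  by rewrite ptN0 group1.
have [a /andP[a0 aH] amin] := ex_minnP exa.
have [e /andP[e0 /existsP[x0 eH]] emin] := ex_minnP exe.
have aP x : (pt x 0 \in H) = (a %| x).
  apply/idP/dvdnP => [xH|[q ->]]; last first.
    by rewrite -[0](muln0 q) -ptX groupX.
  exists (x %/ a); apply/eqP; rewrite {1}(divn_eq x a) -[X in _ == X]addn0 eqn_add2l.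
  have : pt (x %% a) 0 \in H.
    rewrite -(groupMl _ (groupX (x %/ a) aH)) ptX ptM muln0 addn0.
    by rewrite -divn_eq.
  case: posnP => // r0 rH; have := amin (x %% a); rewrite r0 rH => /(_ isT).
  by rewrite leqNgt ltn_mod a0.
have aM : a %| M by rewrite -aP ptM0 group1.
(* Subtracting a multiple of (a, 0) from (x0, e) brings the first coordinate below [a]. *)
pose t := x0 %% a.
have tH : pt t e \in H.
  have kH : pt (x0 %/ a * a) 0 \in H by rewrite aP dvdn_mull.
  by rewrite -(groupMl _ kH) ptM -divn_eq add0n.
have eP x y : pt x y \in H -> e %| y.
  move=> xyH; have : exists x', pt x' (y %% e) \in H.
    (* Subtracting [y %/ e] copies of (t, e) leaves an element of [H] with second coordinate
       [y %% e]. *)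
    have [z1 [z2 [E _ yE]]] := pt_div x y (y %/ e * t) (y %/ e * e).
    exists z1; rewrite (_ : pt _ _ = pt z1 z2); last first.
      apply: pt_eq => //; apply/eqP; rewrite -(eqn_modDr (y %/ e * e)) yE.
      by rewrite addnC -divn_eq.
    by rewrite -(groupMr _ (groupX (y %/ e) tH)) ptX -E.
  case=> x' rH; rewrite /dvdn; case: posnP => // r0.
  have := emin (y %% e); rewrite r0 /= leqNgt ltn_mod e0 /= => ->//.
  apply/existsP; exists (inZp x'); rewrite (_ : pt _ _ = pt x' (y %% e)) //.
  by apply: pt_eq => //=; rewrite modn_mod.
have eN : e %| N.
  by apply: (eP 0); rewrite ptN0 group1.
have aNt : a %| N %/ e * t.
  (* [N %/ e] copies of (t, e) have second coordinate N, which is 0. *)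
  rewrite -aP (_ : pt (N %/ e * t) 0 = pt (N %/ e * t) (N %/ e * e)).
    by rewrite -ptX groupX.
  by apply: pt_eq => //; rewrite divnK // modnn.
have h : hnf (a, e, t) by apply/and3P.
exists a, e, t; split=> //; first by rewrite ltn_mod.
apply/setP => p; rewrite (ptE p) mem_hnf_sub //.
move: (nat_of_ord p.1) (nat_of_ord p.2) => x y {p}.
have [/dvdnP[q ->]|eNy] := boolP (e %| y); last first.
  by apply/negP => /eP; rewrite (negPf eNy).
rewrite mulnK //=.
(* Subtracting [q] copies of (t, e) leaves (z1, 0), which lies in [H] exactly when [a] divides [z1],
   that is, when x and q t agree modulo [a]. *)
have [z1 [z2 [-> xE /eqP]]] := pt_div x (q * e) (q * t) (q * e).
rewrite -[X in _ == X %[mod _]]add0n eqn_modDr => /eqP z20.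
rewrite -ptX groupMr ?groupX // (_ : pt z1 z2 = pt z1 0); last exact: pt_eq.
rewrite aP -(modn_dvdm x aM) -xE modn_dvdm // -[X in _ == X %[mod _]]add0n.
by rewrite eqn_modDr mod0n.
Qed.

Lemma card_subgroups : nb_subgroups M N =
  \sum_(a <- divisors M) \sum_(b <- divisors N) gcdn a b.
Proof.
pose L := [seq (ae, t) | ae <- [seq (a, e) | a <- divisors M, e <- divisors N],
                         t <- [seq t <- iota 0 ae.1 | ae.1 %| (N %/ ae.2) * t]].
have LP u : (u \in L) = hnf u && (u.2 < u.1.1).
  apply/allpairsPdep/idP => [[[a e] [t [/allpairsP[[a' e'] /= [aM eN [-> ->]]]]]]|].
    rewrite mem_filter mem_iota /= => /andP[aNt ta] -> /=.
    by move: aM eN; rewrite -!dvdn_divisors // => -> ->; rewrite aNt.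
  case: u => [[a e] t] /= /andP[/and3P[aM eN aNt] ta]; exists (a, e), t.
  by rewrite allpairs_f -?dvdn_divisors // mem_filter aNt mem_iota.
have Lu : uniq L.
  apply: allpairs_uniq_dep => [|ae _|[? ?] [? ?] _ _ [-> ->] //].
    by rewrite allpairs_uniq ?divisors_uniq // => -[? ?] [? ?].
  by rewrite filter_uniq ?iota_uniq.
pose S := [seq hnf_sub u.1.1 u.1.2 u.2 | u <- L].
have -> : nb_subgroups M N = size S.
  rewrite /nb_subgroups cardE -(size_map val); apply/perm_size/uniq_perm.
  - by rewrite map_inj_uniq ?enum_uniq //; apply: val_inj.
  - rewrite map_inj_in_uniq // => -[[a e] t] [[a' e'] t'].
    by rewrite !LP => /andP[h ta] /andP[h' ta']; apply: hnf_sub_inj.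
  move=> A; apply/mapP/mapP => [[H _ ->]|[[[a e] t]]].
    have [a [e [t [h ta HE]]]] := hnf_sub_surj H.
    by exists (a, e, t); rewrite ?LP ?h.
  rewrite LP => /andP[h _] ->; exists (group (hnf_sub_group_set h)) => //.
  by rewrite mem_enum.
rewrite size_map -sum1_size big_allpairs_dep big_allpairs /=.
rewrite big_seq [RHS]big_seq; apply: eq_bigr => a aM.
have a0 : 0 < a by move: aM; rewrite -dvdn_divisors // => /dvdn_gt0; apply.
(* The second divisor in the formula is [b = N %/ e]. *)
rewrite -[RHS]big_divisors_inv //; apply: eq_bigr => e _.
by rewrite big_filter count_dvdn_mul.
Qed.

End lattice.

(** * Totients and the count of cyclic subgroups *)

(** The product runs over all primes below a free bound [K], so that the totients of several numbers
    can be multiplied prime by prime. *)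
Lemma totient_logn n K : 0 < n -> n < K ->
  totient n = \prod_(0 <= p < K | prime p)
    (if logn p n is k.+1 then p.-1 * p ^ k else 1).
Proof.
move=> n0 nK; rewrite totientE //.
rewrite [RHS](bigID (mem (primes n))) /= [X in _ * X]big1 ?muln1; last first.
  by move=> p /andP[_]; rewrite -logn_gt0 lt0n negbK => /eqP ->.
rewrite -[RHS]big_filter big_seq [RHS](perm_big (primes n)); last first.
  rewrite uniq_perm ?filter_uniq ?iota_uniq ?primes_uniq // => p.
  rewrite mem_filter mem_index_iota /= mem_primes.
  case: (prime p) => //=; rewrite n0 /=; case pn: (p %| n) => //=.
  by apply: leq_ltn_trans nK; apply: dvdn_leq.
rewrite [RHS]big_seq; apply: eq_bigr => p; rewrite -logn_gt0.
by case: logn.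
Qed.

(** At each prime the exponents in the gcd and the lcm are the minimum and maximum of those in [a]
    and [b], so both sides have the same two local factors. *)
Lemma totient_gcd_lcm a b : 0 < a -> 0 < b ->
  totient a * totient b = totient (gcdn a b) * totient (lcmn a b).
Proof.
move=> a0 b0; have l0 : 0 < lcmn a b by rewrite lcmn_gt0 a0.
have la : a <= lcmn a b by rewrite dvdn_leq ?dvdn_lcml.
have lb : b <= lcmn a b by rewrite dvdn_leq ?dvdn_lcmr.
have lg : gcdn a b <= lcmn a b by apply: leq_trans la; rewrite dvdn_leq ?dvdn_gcdl.
rewrite !(@totient_logn _ (lcmn a b).+1) ?gcdn_gt0 ?a0 // -!big_split /=.
apply: eq_bigr => p pp; rewrite logn_gcd // logn_lcm //.
by case: leqP => _; rewrite // mulnC.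
Qed.

(** A cyclic group has one subgroup of each order d dividing its order, and the elements of order d
    are the [totient d] generators of that subgroup. *)
Lemma sum_order_cyclic (gT : finGroupType) (V : nmodType) (F : nat -> V) :
  cyclic [set: gT] ->
  (\sum_(x : gT) F #[x] = \sum_(d <- divisors #|gT|) F d *+ totient d)%R.
Proof.
case/cyclicP => g gE; have og : #[g] = #|gT| by rewrite /order -gE cardsT.
have T0 : 0 < #|gT| by rewrite -og order_gt0.
(* Each term is written as a sum over the single divisor [d = #[x]], so that the two sums can be
   exchanged. *)
rewrite (eq_bigr (fun x => \sum_(d <- divisors #|gT| | d == #[x]) F d)%R); last first.
  move=> x _; rewrite -big_filter filter_pred1_uniq ?divisors_uniq ?big_seq1 //.
  by rewrite -dvdn_divisors // -cardsT (@order_dvdG _ [set: gT]%G) ?finset.in_setT.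
rewrite (exchange_big_dep xpredT) //= big_seq [RHS]big_seq; apply: eq_bigr => d.
rewrite -dvdn_divisors // -og => dg; rewrite sumr_const; congr (_ *+ _)%R.
pose y := g ^+ (#[g] %/ d).
have d0 : 0 < d by apply: dvdn_gt0 dg; rewrite og.
have oy : #[y] = d by rewrite orderXdiv ?dvdn_div // divnA // mulKn.
rewrite -[in RHS]oy totient_gen cardsE; apply: eq_card => x.
rewrite -[LHS]/(d == #[x]) -[RHS]/(<[y]> == <[x]>).
have := cycle_sub_group dg; rewrite -/y => /setP/(_ <[x]>%G).
rewrite !inE -gE finset.subsetT /= -[#|_|]/(#[x]) eq_sym => ->.
by rewrite eq_sym -val_eqE.
Qed.

Lemma order_pair (aT bT : finGroupType) (x : aT) (y : bT) :
  #[(x, y)] = lcmn #[x] #[y].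
Proof.
apply/eqP; rewrite eqn_dvd; have XE k : (x, y) ^+ k = (x ^+ k, y ^+ k).
  by elim: k => // k IHk; rewrite !expgS IHk.
rewrite order_dvdn XE dvdn_lcm !order_dvdn.
have /eqP := expg_order (x, y); rewrite XE => /andP[/= -> ->].
rewrite !andbT; apply/eqP; congr (_, _); apply/eqP; rewrite -order_dvdn.
  exact: dvdn_lcml.
exact: dvdn_lcmr.
Qed.

Lemma cyclic_Iord k : cyclic [set: 'I_k.+1].
Proof.
apply/cyclicP; exists (inZp 1); apply/setP => x; rewrite inE; apply/esym/cycleP.
by exists x; rewrite Zp_expg; apply: val_inj; rewrite /= modnMml mul1n modn_small.
Qed.

(** Elements are grouped by the subgroup they generate; a cyclic subgroup of order d collects
    [totient d] equal weights. *)
Lemma card_cyclic_sum (gT : finGroupType) :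
  (#|[pred H : {group gT} | cyclic H]|%:R =
   \sum_(x : gT) (totient #[x])%:R^-1 :> rat)%R.
Proof.
rewrite (partition_big (fun x => <[x]>%G) (fun H : {group gT} => cyclic H)) /=;
  last by move=> x _; apply: cycle_cyclic.
rewrite -sum1_card natr_sum; apply: eq_bigr => H /cyclicP[y Hy].
have -> : H = <[y]>%G by apply: val_inj.
rewrite (eq_bigr (fun=> (totient #[y])%:R^-1)%R); last first.
  by move=> x /eqP/(congr1 (fun K : {group gT} => #|K|)); rewrite /order /= => ->.
rewrite sumr_const (_ : #|_| = totient #[y]); last first.
  rewrite totient_gen cardsE; apply: eq_card => x.
  by rewrite -[LHS]/(<[x]> == <[y]>) eq_sym.
by rewrite -[RHS]mulr_natl mulfV // pnatr_eq0 -lt0n totient_gt0.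
Qed.

Lemma card_cyclic_subgroups m n : 0 < m -> 0 < n -> nb_cyclic_subgroups m n =
  \sum_(a <- divisors m) \sum_(b <- divisors n) totient (gcdn a b).
Proof.
case: m n => [|m] [|n] // _ _; apply/eqP; rewrite -(eqr_nat rat); apply/eqP.
rewrite /nb_cyclic_subgroups card_cyclic_sum natr_sum.
rewrite (eq_bigr (fun p : ZxZ m.+1 n.+1 =>
  (totient (lcmn #[p.1] #[p.2]))%:R^-1))%R; last first.
  by move=> [x y] _; rewrite order_pair.
rewrite -(pair_bigA _ (fun x y => (totient (lcmn #[x] #[y]))%:R^-1))%R /=.
rewrite (sum_order_cyclic (fun a => \sum_y (totient (lcmn a #[y]))%:R^-1)%R
  (cyclic_Iord m)).
rewrite card_ord big_seq [RHS]big_seq; apply: eq_bigr => a.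
rewrite -dvdn_divisors // => am.
rewrite (sum_order_cyclic (fun b => (totient (lcmn a b))%:R^-1)%R (cyclic_Iord n)).
rewrite card_ord natr_sum -sumrMnl big_seq [RHS]big_seq; apply: eq_bigr => b.
rewrite -dvdn_divisors // => bn.
have a0 : 0 < a by apply: dvdn_gt0 am.
have b0 : 0 < b by apply: dvdn_gt0 bn.
(* The [totient a * totient b] pairs with component orders a and b have weight 1 /
   [totient (lcmn a b)] each, for a total of [totient (gcdn a b)]. *)
rewrite -mulrnA -[LHS]mulr_natr mulnC totient_gcd_lcm // natrM mulrCA mulVf ?mulr1 //.
by rewrite pnatr_eq0 -lt0n totient_gt0 lcmn_gt0 a0.
Qed.

End counting.

Local Open Scope classical_set_scope.
Local Open Scope ring_scope.
Local Open Scope complex_scope.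

Lemma sum_totient_divisors n : (0 < n)%N -> (\sum_(d <- divisors n) totient d)%N = n.
Proof.
case: n => // n _; have := @sum_order_cyclic _ nat (fun=> 1%N) (cyclic_Iord n).
rewrite sum1_card card_ord => E; rewrite [RHS]E; apply: eq_bigr => d _.
by rewrite -[RHS]mulr_natl mulr1 natn.
Qed.

(** * Unconditional summation of complex families *)

#[local] Existing Instance totally_filter.

Lemma partial_sumE (I : choiceType) (V : zmodType) (f : I -> V)
    (A : {fset I}) : partial_sum f A = \sum_(i <- A) f i.
Proof. by rewrite [RHS]big_seq_fsetE. Qed.

(** Changes of index set below all reduce to this cofinality criterion. *)
Lemma cvg_totally (I K : choiceType) (u : {fset I} -> {fset K}) :
  (forall A0, exists B0, forall B, (B0 `<=` B -> A0 `<=` u B)%fset) ->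
  u @ totally `=>` totally.
Proof.
move=> H P [A0 _ AP]; have [B0 HB] := H A0.
by exists B0 => // B /= ?; apply: AP; apply: HB.
Qed.

Section complex_summation.
Variable R : realType.
Notation C := (CC R).

Lemma normcCE (x : C) : `|x| = (normc x)%:C.
Proof. by []. Qed.

Lemma cvg_complex (T : Type) (F : set_system T) (FF : Filter F)
    (u v : T -> R) (a b : R) :
  u @ F --> a -> v @ F --> b ->
  (fun t => u t +i* v t : C) @ F --> (a +i* b : C).
Proof.
move=> /cvgrPdist_lt ua /cvgrPdist_lt vb; apply/cvgrPdist_lt => e e0.
(* The radius is a positive element of [C], hence real. *)
have [d de] : exists d : R, e = d%:C.
  by exists (complex.Re e); rewrite RRe_real // gtr0_real.
have d0 : 0 < d / 2 by rewrite divr_gt0 //; rewrite de ltcR in e0.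
near=> t.
have -> : (a +i* b : C) - (u t +i* v t) = (a - u t)%:C + 'i * (b - v t)%:C.
  by simpc.
apply: (le_lt_trans (ler_normD _ _)); rewrite normrM.
rewrite !normcCE -!rmorphM -rmorphD de /= ltcR !expr0n /= expr1n !addr0 add0r.
rewrite !sqrtr_sqr sqrtr1 mul1r [ltRHS]splitr ltrD //.
- by near: t; apply: ua.
- by near: t; apply: vb.
Unshelve. all: by end_near. Qed.

Section families.
Variable I : choiceType.
Implicit Types f g : I -> C.

Definition has_sum f (l : C) : Prop := partial_sum f @ totally --> l.

Definition abs_bounded f : Prop :=
  exists M : R, forall A : {fset I}, \sum_(i <- A) normc (f i) <= M.

(** The bound is carried along with the sum because it is what makes product families summable. *)
Definition abs_sum f (l : C) : Prop := abs_bounded f /\ has_sum f l.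

Lemma abs_bounded_le f g :
  (forall i, normc (f i) <= normc (g i)) -> abs_bounded g -> abs_bounded f.
Proof.
move=> fg [M HM]; exists M => A; apply: le_trans (HM A).
by apply: ler_sum => i _.
Qed.

Lemma sub_sum_fset (r : I -> R) (A B : {fset I}) : (forall i, 0 <= r i) ->
  (A `<=` B)%fset -> \sum_(i <- A) r i <= \sum_(i <- B) r i.
Proof.
move=> r0 /fsetIidPr <-.
rewrite [leRHS](big_fsetID _ (mem A)) /=.
rewrite [X in _ <= X + _](_ : _ = \sum_(i <- (B `&` A)%fset) r i).
  by rewrite lerDl sumr_ge0.
by apply: eq_fbigl => i; rewrite !inE.
Qed.

(** The finite sums increase with the index set, so they tend to their supremum. *)
Lemma nneg_has_sum (r : I -> R) (M : R) : (forall i, 0 <= r i) ->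
  (forall A : {fset I}, \sum_(i <- A) r i <= M) ->
  cvg (partial_sum r @ totally).
Proof.
move=> r0 HM.
pose S := [set \sum_(i <- A) r i | A in [set: {fset I}]]%classic.
have hS : has_sup S.
  split; first by exists (\sum_(i <- fset0) r i), fset0.
  by exists M => _ [A _ <-].
apply/cvg_ex; exists (sup S); apply/cvgrPdist_lt => e e0.
have [_ [A0 _ <-] HA] := sup_adherent e0 hS.
exists A0 => // A /= A0A; rewrite partial_sumE.
have AS : \sum_(i <- A) r i <= sup S by apply: ub_le_sup; [case: hS|exists A].
rewrite ger0_norm ?subr_ge0 // ltrBlDr -ltrBlDl.
exact: lt_le_trans (sub_sum_fset r0 A0A).
Qed.

Lemma real_has_sum (r : I -> R) (M : R) :
  (forall A : {fset I}, \sum_(i <- A) `|r i| <= M) ->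
  cvg (partial_sum r @ totally).
Proof.
move=> HM.
(* A difference of two nonnegative families, with finite sums bounded by [M] and by [M + M]. *)
have -> : partial_sum r =
    partial_sum (fun i => `|r i|) - partial_sum (fun i => `|r i| - r i).
  apply/funext => A; rewrite /= !fctE !partial_sumE -sumrB.
  by apply: eq_bigr => i _; rewrite subKr.
apply: is_cvgB; first by apply: (@nneg_has_sum _ M).
apply: (@nneg_has_sum _ (M + M)) => [i|A].
  by rewrite subr_ge0 ler_norm.
apply: le_trans (lerD (HM A) (HM A)); rewrite -big_split /=.
by apply: ler_sum => i _; rewrite lerD2l -normrN ler_norm.
Qed.

Lemma norm_Re (x : R[i]) : `|complex.Re x| <= normc x.
Proof. by rewrite -lecR -[leRHS]/(`|x|) normc_ge_Re. Qed.

Lemma norm_Im (x : R[i]) : `|complex.Im x| <= normc x.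
Proof.
case: x => a b /=; rewrite -sqrtr_sqr ler_sqrt ?addr_ge0 ?sqr_ge0 //.
by rewrite lerDr sqr_ge0.
Qed.

Lemma abs_bounded_sum f : abs_bounded f -> exists l, abs_sum f l.
Proof.
move=> fb; have [M HM] := fb.
have /cvg_ex[/= a ca] : cvg (partial_sum (fun i => complex.Re (f i)) @ totally).
  apply: (@real_has_sum _ M) => A; apply: le_trans (HM A).
  by apply: ler_sum => i _; apply: norm_Re.
have /cvg_ex[/= b cb] : cvg (partial_sum (fun i => complex.Im (f i)) @ totally).
  apply: (@real_has_sum _ M) => A; apply: le_trans (HM A).
  by apply: ler_sum => i _; apply: norm_Im.
exists (a +i* b); split=> //; rewrite /has_sum.
have -> : partial_sum f = fun A => partial_sum (fun i => complex.Re (f i)) A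
    +i* partial_sum (fun i => complex.Im (f i)) A.
  apply/funext => A; rewrite !partial_sumE.
  elim/big_rec3 : _ => [//|i x y z _ ->]; by case: (f i).
exact: cvg_complex.
Qed.

Lemma has_sum_unique f l m : has_sum f l -> has_sum f m -> l = m.
Proof. by move=> fl fm; apply: cvg_unique fl fm; apply: norm_hausdorff. Qed.

End families.

(** * Regrouping along finite fibers and products of families *)

Lemma sum_fset_seq (I : choiceType) (V : nmodType) (f : I -> V) (s : seq I) :
  uniq s -> \sum_(i <- [fset x in s]%fset) f i = \sum_(i <- s) f i.
Proof.
move=> su; apply: perm_big; apply: uniq_perm => // i.
by rewrite inE.
Qed.

Lemma sum_fibers (I K : choiceType) (V : nmodType) (f : I -> V) (h : I -> K)
    (fib : K -> seq I) (B : {fset K}) :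
  (forall k, uniq (fib k)) -> (forall k i, (i \in fib k) = (h i == k)) ->
  \sum_(k <- B) \sum_(i <- fib k) f i =
  \sum_(i <- [fset i in [seq i | k <- B, i <- fib k]]%fset) f i.
Proof.
move=> fibu fibE; rewrite sum_fset_seq ?big_allpairs_dep //.
apply: allpairs_uniq_dep => //.
move=> _ _ /allpairsPdep[k [i [_ ik ->]]] /allpairsPdep[k' [i' [_ ik' ->]]] /= ii'.
move: ik ik'; rewrite ii' !fibE => /eqP kE /eqP kE'.
by rewrite -kE -kE'.
Qed.

Lemma mem_fibers (I K : choiceType) (h : I -> K) (fib : K -> seq I)
    (B : {fset K}) i : (forall k i, (i \in fib k) = (h i == k)) ->
  (i \in [fset i in [seq i | k <- B, i <- fib k]]%fset) = (h i \in B).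
Proof.
move=> fibE; rewrite inE; apply/allpairsPdep/idP => [[k [j [kB + ->]]]|hB].
  by rewrite fibE => /eqP ->.
by exists (h i), i; rewrite fibE.
Qed.

Lemma sum_rectangle (I J : choiceType) (V : nzRingType) (f : I -> V) (g : J -> V)
    (A : {fset I}) (B : {fset J}) :
  \sum_(p <- [fset p in [seq (i, j) | i <- A, j <- B]]%fset) f p.1 * g p.2 =
  (\sum_(i <- A) f i) * (\sum_(j <- B) g j).
Proof.
rewrite sum_fset_seq; last by apply: allpairs_uniq => // -[? ?] [? ?].
rewrite big_allpairs big_distrl; apply: eq_bigr => i _ /=.
by rewrite big_distrr.
Qed.

Lemma sub_rectangle (I J : choiceType) (A : {fset I * J}) :
  (A `<=` [fset p in [seq (i, j) | i <- [fset p.1 | p in A],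
                                   j <- [fset p.2 | p in A]]])%fset.
Proof.
apply/fsubsetP => -[i j] ijA; rewrite inE; apply: allpairs_f.
  by apply/imfsetP; exists (i, j).
by apply/imfsetP; exists (i, j).
Qed.

Section products.
Variables I J K : choiceType.

Lemma normc_ge0 (x : R[i]) : 0 <= normc x.
Proof. by case: x => a b; rewrite sqrtr_ge0. Qed.

Lemma normc_sum (T : Type) (s : seq T) (f : T -> C) :
  normc (\sum_(i <- s) f i) <= \sum_(i <- s) normc (f i).
Proof.
elim/big_rec2 : _ => [|i y x _ yx]; first by rewrite normc0.
exact: le_trans (le_normcD _ _) (lerD _ _).
Qed.

Lemma abs_bounded_fibers (f : I -> C) (F : K -> C) (h : I -> K)
    (fib : K -> seq I) :
  (forall k, uniq (fib k)) -> (forall k i, (i \in fib k) = (h i == k)) ->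
  (forall k, F k = \sum_(i <- fib k) f i) -> abs_bounded f -> abs_bounded F.
Proof.
move=> fibu fibE FE [M HM]; exists M => B.
apply: le_trans (HM [fset i in [seq i | k <- B, i <- fib k]]%fset).
rewrite -(@sum_fibers _ _ _ _ h) //; apply: ler_sum => k _.
by rewrite FE normc_sum.
Qed.

(** A partial sum of [F] over [B] is the partial sum of [f] over the preimage of [B], and this
    preimage contains [A] once [B] contains the image of [A]. *)
Lemma has_sum_fibers (f : I -> C) (F : K -> C) (h : I -> K)
    (fib : K -> seq I) l :
  (forall k, uniq (fib k)) -> (forall k i, (i \in fib k) = (h i == k)) ->
  (forall k, F k = \sum_(i <- fib k) f i) -> has_sum f l -> has_sum F l.
Proof.
move=> fibu fibE FE fl; rewrite /has_sum.
pose U (B : {fset K}) := [fset i in [seq i | k <- B, i <- fib k]]%fset.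
have -> : partial_sum F = partial_sum f \o U.
  apply/funext => B; rewrite /= !partial_sumE -(@sum_fibers _ _ _ _ h) //.
  exact: eq_bigr.
suff cU : U @ totally `=>` totally by exact: cvg_comp cU fl.
apply: cvg_totally => A; exists [fset h i | i in A]%fset => B AB.
apply/fsubsetP => i iA; rewrite (mem_fibers (h := h)) //.
by apply: (fsubsetP AB); apply/imfsetP; exists i.
Qed.

(** A finite set of pairs lies in the rectangle of its projections, over which the sum of moduli
    factors. *)
Lemma abs_bounded_prod (f : I -> C) (g : J -> C) :
  abs_bounded f -> abs_bounded g ->
  abs_bounded (fun p : I * J => f p.1 * g p.2).
Proof.
move=> [M HM] [N HN]; exists (M * N) => A.
apply: le_trans (sub_sum_fset _ (sub_rectangle A)) _ => [p|].
  exact: normc_ge0.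
rewrite (eq_bigr (fun p => normc (f p.1) * normc (g p.2))); last first.
  by move=> p _; apply: normcM.
rewrite (sum_rectangle (fun i => normc (f i)) (fun j => normc (g j))).
by rewrite ler_pM ?sumr_ge0 // => i _; apply: normc_ge0.
Qed.

Lemma abs_sum_prod (f : I -> C) (g : J -> C) l m :
  abs_sum f l -> abs_sum g m ->
  abs_sum (fun p : I * J => f p.1 * g p.2) (l * m).
Proof.
move=> [fb fl] [gb gm]; have bb := abs_bounded_prod fb gb.
(* The bound gives some sum [L]; it is identified with [l * m] by restricting to rectangles, which
   are cofinal among finite sets of pairs. *)
have [L [_ HL]] := abs_bounded_sum bb; split; first exact: bb.
suff -> : l * m = L by exact: HL.
pose F : set_system ({fset I} * {fset J}) := filter_prod totally totally.
have h1 : (fun p : {fset I} * {fset J} => partial_sum f p.1 * partial_sum g p.2) @ F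
    --> l * m.
  have F1 : fst @ F `=>` totally by exact: cvg_fst.
  have F2 : snd @ F `=>` totally by exact: cvg_snd.
  exact: (cvgM (cvg_comp _ _ F1 fl) (cvg_comp _ _ F2 gm)).
apply: (cvg_unique _ h1); first exact: norm_hausdorff.
pose U (p : {fset I} * {fset J}) :=
  [fset q in [seq (i, j) | i <- p.1, j <- p.2]]%fset.
have -> : (fun p : {fset I} * {fset J} => partial_sum f p.1 * partial_sum g p.2) =
    partial_sum (fun p => f p.1 * g p.2) \o U.
  by apply/funext => -[A B]; rewrite /= !partial_sumE sum_rectangle.
suff cU : U @ F `=>` totally by exact: cvg_comp cU HL.
move=> P [A0 _ AP].
exists ([set A | [fset p.1 | p in A0] `<=` A]%fset,
        [set A | [fset p.2 | p in A0] `<=` A]%fset).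
  by split; [exists [fset p.1 | p in A0]%fset|exists [fset p.2 | p in A0]%fset].
move=> [A B] [/= sA sB]; apply: AP => /=.
apply/fsubsetP => -[i j] ijA; rewrite inE; apply: allpairs_f.
  by apply: (fsubsetP sA); apply/imfsetP; exists (i, j).
by apply: (fsubsetP sB); apply/imfsetP; exists (i, j).
Qed.

End products.

(** Common source of the three Dirichlet convolutions below, with [h] the multiplication of
    indices. *)
Lemma abs_sum_convolution (I J K : choiceType) (f : I -> C) (g : J -> C)
    (F : K -> C) (h : I * J -> K) (fib : K -> seq (I * J)) l m :
  (forall k, uniq (fib k)) -> (forall k p, (p \in fib k) = (h p == k)) ->
  (forall k, F k = \sum_(p <- fib k) f p.1 * g p.2) ->
  abs_sum f l -> abs_sum g m -> abs_sum F (l * m).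
Proof.
move=> fibu fibE FE fl gm; have [bb HS] := abs_sum_prod fl gm; split.
  exact: abs_bounded_fibers FE bb.
exact: has_sum_fibers FE HS.
Qed.

End complex_summation.

(** * The zeta function on the half-plane of convergence *)

Section zeta_theory.
Variable R : realType.
Notation C := (CC R).
Implicit Types (s z w : R[i]) (m n : nat).

Lemma expCD z w : expC (z + w) = expC z * expC w.
Proof.
case: z w => [a b] [c d]; rewrite /expC /= expRD cosD sinD.
apply/eqP; rewrite eq_complex /=; apply/andP; split; apply/eqP; ring.
Qed.

Lemma normc_expC z : normc (expC z) = expR (complex.Re z).
Proof.
by rewrite /expC /= !exprMn -mulrDr cos2Dsin2 mulr1 sqrtr_sqr ger0_norm ?expR_ge0.
Qed.

Lemma npowCM m n s : (0 < m)%N -> (0 < n)%N ->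
  npowC (m * n) s = npowC m s * npowC n s.
Proof.
move=> m0 n0; rewrite /npowC -expCD natrM lnM ?posrE ?ltr0n //.
by rewrite rmorphD mulrDr.
Qed.

Lemma npowCD n z w : npowC n (z + w) = npowC n z * npowC n w.
Proof. by rewrite /npowC mulrDl expCD. Qed.

Lemma npowC1 n : (0 < n)%N -> npowC n 1 = n%:R :> R[i].
Proof.
move=> n0; rewrite /npowC mul1r /expC /= lnK ?posrE ?ltr0n //.
by rewrite cos0 sin0 mulr1 mulr0 -[LHS]/((n%:R)%:C) rmorph_nat.
Qed.

Lemma normc_npowC n s : normc (npowC n s) = expR (complex.Re s * ln n%:R).
Proof.
rewrite /npowC normc_expC; case: s => a b /=.
by rewrite mulr0 subr0.
Qed.

(* Cauchy condensation: r is compared with its value at the left end of each dyadic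
   block [2 ^ j, 2 ^ j.+1). *)
Lemma dyadic_sum_le (r : nat -> R) (q : R) : 0 <= q < 1 ->
  (forall n, 0 <= r n) -> {homo r : m n / (m <= n)%N >-> m >= n} ->
  (forall j, 2 ^+ j * r (2 ^ j)%N <= q ^+ j) ->
  forall A : {fset nat}, \sum_(k <- A | k != 0%N) r k.+1 <= q / (1 - q).
Proof.
move=> /andP[q0 q1] r0 rd rq A.
(* The sum starts at n = 2, since the index k = 0, that is n = 1, is left out; the bound is then a
   geometric sum without its term 1. *)
have block j : \sum_(2 <= n < 2 ^ j.+1) r n <= \sum_(i < j) q ^+ i.+1.
  elim: j => [|j IHj]; first by rewrite big_geq // big_ord0.
  rewrite (@big_cat_nat _ _ _ (2 ^ j.+1)) /=; last 2 first.
  - by rewrite (leq_pexp2l _ (isT : (0 < j.+1)%N)).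
  - by rewrite leq_pexp2l.
  rewrite big_ord_recr lerD //=; apply: le_trans (rq j.+1).
  apply: (@le_trans _ _ (\sum_(2 ^ j.+1 <= n < 2 ^ j.+2) r (2 ^ j.+1)%N)).
    by rewrite !big_seq; apply: ler_sum => n; rewrite mem_index_iota => /andP[/rd].
  by rewrite sumr_const_nat -[leLHS]mulr_natl -natrX expnS mul2n -addnn addnK.
have geo j : \sum_(i < j) q ^+ i.+1 <= q / (1 - q).
  rewrite ler_pdivlMr ?subr_gt0 //.
  under eq_bigr do rewrite exprS.
  rewrite -mulr_sumr -mulrA ler_piMr // mulrC -opprB mulNr -subrX1 opprB.
  by rewrite lerBlDr lerDl exprn_ge0.
have [N AN] : exists N, forall k, k \in A -> (k <= N)%N.
  exists (\max_(k <- A) k)%N => k kA.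
  exact: (@leq_bigmax_seq _ (enum_fset A) predT id).
apply: le_trans (le_trans (block N.+1) (geo _)).
rewrite -big_filter.
apply: (@le_trans _ _ (\sum_(k <- [fset k in [seq k <- A | k != 0%N]]%fset) r k.+1)).
  by rewrite sum_fset_seq // filter_uniq // fset_uniq.
apply: (@le_trans _ _ (\sum_(k <- [fset k in iota 1 N]%fset) r k.+1)).
  apply: (@sub_sum_fset _ _ (fun k => r k.+1)) => [k|]; first exact: r0.
  apply/fsubsetP => k; rewrite !inE mem_filter mem_iota => /andP[k0 /AN kN].
  by rewrite lt0n k0 add1n ltnS.
rewrite sum_fset_seq ?iota_uniq // -(big_map S xpredT).
rewrite (_ : map S _ = index_iota 2 N.+2); last first.
  by rewrite /index_iota subn2 (iotaDl 1 1).
(* The range is enlarged to end at a power of two, using [N.+2 <= 2 ^ N.+2]. *)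
rewrite [leRHS](@big_cat_nat _ _ _ N.+2) //=; last first.
  exact/ltnW/ltn_expl.
by rewrite lerDl sumr_ge0.
Qed.

(** Condensation with ratio q = 2 ^ (1 - Re s). Leaving out the term 1 gives a bound that also
    serves for the nonvanishing of zeta. *)
Lemma npowC_sum_le s (A : {fset nat}) : 1 < complex.Re s ->
  \sum_(k <- A | k != 0%N) normc (npowC k.+1 s)^-1 <=
  expR ((1 - complex.Re s) * ln 2) / (1 - expR ((1 - complex.Re s) * ln 2)).
Proof.
set a := complex.Re s => a1; set q := expR _.
have ln2 : 0 < ln 2 :> R by rewrite ln_gt0 // ltr1n.
have a0 : 0 < a by apply: lt_trans a1.
have q1 : q < 1 by rewrite -expR0 ltr_expR pmulr_llt0 // subr_lt0.
have -> : \sum_(k <- A | k != 0%N) normc (npowC k.+1 s)^-1 =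
    \sum_(k <- A | k != 0%N) expR (- (a * ln (maxn 1 k.+1)%:R)).
  by apply: eq_bigr => k _; rewrite normcV normc_npowC expRN (maxn_idPr _).
(* [maxn 1 n] gives 0 the value taken at 1, which keeps the function nonincreasing on all of
   [nat]. *)
apply: (@dyadic_sum_le (fun n => expR (- (a * ln (maxn 1 n)%:R))) q).
- by rewrite expR_ge0.
- by move=> n; apply: expR_ge0.
- move=> m n mn; rewrite ler_expR lerN2 ler_pM2l // ler_ln ?posrE ?ltr0n; try lia.
  by rewrite ler_nat; lia.
- move=> j; rewrite (maxn_idPr _) ?expn_gt0 // natrX lnXn //.
  rewrite -expRM_natl -[X in X ^+ j](@lnK R 2) ?posrE // -expRM_natl -expRD.
  by rewrite ler_expR -[ln 2 *+ j]mulr_natl; lra.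
Qed.

Lemma npowC_abs_bounded s : 1 < complex.Re s ->
  abs_bounded (fun k => (npowC k.+1 s)^-1 : C).
Proof.
move=> s1; pose q := expR ((1 - complex.Re s) * ln 2).
exists (normc (npowC 1 s)^-1 + q / (1 - q)) => A.
rewrite (bigID (fun k => k == 0%N)) /= lerD ?npowC_sum_le //.
have [A0|A0] := boolP (0%N \in A).
  by rewrite -big_filter filter_pred1_uniq ?fset_uniq // big_seq1.
rewrite big_seq_cond big_pred0 ?normc_ge0 // => k.
by apply/negP => /andP[kA /eqP k0]; rewrite -k0 kA in A0.
Qed.

(** Initial segments are cofinal among finite sets of indices, so the ordered series that defines
    [zeta] converges to the unconditional sum. *)
Lemma zeta_abs_sum s : 1 < complex.Re s ->
  abs_sum (fun k => (npowC k.+1 s)^-1 : C) (zeta s).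
Proof.
move=> s1; have [l [lb sl]] := abs_bounded_sum (npowC_abs_bounded s1).
split; first exact: lb.
rewrite /zeta.
suff c : series (fun k => (npowC k.+1 s)^-1 : C) @ \oo --> l.
  have -> : limn (series (fun k => (npowC k.+1 s)^-1 : C)) = l.
    by apply: cvg_lim => //; apply: norm_hausdorff.
  exact: sl.
pose U (n : nat) := [fset k in iota 0 n]%fset.
have -> : series (fun k => (npowC k.+1 s)^-1 : C) =
    partial_sum (fun k => (npowC k.+1 s)^-1 : C) \o U.
  apply/funext => n; rewrite /= partial_sumE sum_fset_seq ?iota_uniq //.
  by rewrite /series /= /index_iota subn0.
suff cU : U @ \oo `=>` totally by exact: cvg_comp cU sl.
move=> P [A0 _ AP]; exists (\max_(k <- A0) k).+1 => // n /= nA; apply: AP => /=.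
apply/fsubsetP => k kA; rewrite !inE mem_iota add0n /=.
apply: leq_trans nA; rewrite ltnS.
exact: (@leq_bigmax_seq _ (enum_fset A0) predT id).
Qed.

(** A partial sum containing the term 1 has modulus at least 1 - q / (1 - q), so zero cannot be the
    limit. The half-plane is the one where z + w lies. *)
Lemma zeta_neq0 s : 2 < complex.Re s -> zeta s != 0.
Proof.
move=> s2; have s1 : 1 < complex.Re s by apply: lt_trans s2; rewrite ltr1n.
apply/eqP => z0; have [_] := zeta_abs_sum s1; rewrite z0.
pose q := expR ((1 - complex.Re s) * ln 2).
have ln2 : 0 < ln 2 :> R by rewrite ln_gt0 // ltr1n.
(* This makes q / (1 - q) less than 1, and is where Re s > 2 enters. *)
have q2 : q < 2^-1.
  rewrite -[ltRHS]lnK ?posrE // lnV ?posrE // ltr_expR.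
  by rewrite -[ltRHS]mulN1r ltr_pM2r //; lra.
have c1 : 0 < 1 - q / (1 - q).
  by rewrite subr_gt0 ltr_pdivrMr ?mul1r; lra.
move=> /cvgrPdist_lt /(_ (1 - q / (1 - q))%:C).
rewrite ltcR => /(_ c1)[A0 _ /(_ (0%N |` A0)%fset)] /=.
rewrite fsubsetU1 => /(_ isT); rewrite sub0r normrN partial_sumE normcCE ltcR.
apply/negP; rewrite -leNgt.
rewrite (bigD1_seq 0%N) ?fset_uniq ?fset1U1 //=.
set S := \sum_(_ <- _ | _) _.
have -> : (npowC 1 s)^-1 = 1 :> R[i].
  by rewrite /npowC ln1 mulr0 /expC /= expR0 cos0 sin0 mulr0 mulr1 invr1.
have : normc 1 <= normc (1 + S) + normc S.
  by rewrite -[X in normc X <= _](addrK S) -(normcN S) le_normcD.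
rewrite normc1 -lerBlDr; apply: le_trans; rewrite lerB //.
apply: le_trans (npowC_sum_le (0%N |` A0)%fset s1).
by rewrite /S -[X in normc X]big_filter -[leRHS]big_filter; apply: normc_sum.
Qed.

End zeta_theory.

(** * Dirichlet convolution *)

(* The index k of a series stands for the positive integer k.+1, hence the shifts:
   the fibers over k.+1, and over (m.+1, n.+1), of (i, j) |-> i j, of
   (d, (i, j)) |-> (d i, d j) and of the componentwise product of pairs. *)
Definition product_fiber k := [seq (d.-1, (k.+1 %/ d).-1)%N | d <- divisors k.+1].

Definition diagonal_fiber m n :=
  [seq (d.-1, ((m.+1 %/ d).-1, (n.+1 %/ d).-1))%N | d <- divisors (gcdn m.+1 n.+1)].

Definition pairwise_fiber m n :=
  [seq ((a.-1, b.-1), ((m.+1 %/ a).-1, (n.+1 %/ b).-1))%N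
  | a <- divisors m.+1, b <- divisors n.+1].

Lemma divisor_gt0 n d : d \in divisors n.+1 -> (0 < d)%N.
Proof. by rewrite -dvdn_divisors // => /dvdn_gt0; apply. Qed.

Lemma divisor_pred n d : (d %| n.+1)%N ->
  [/\ d.-1.+1 = d, (n.+1 %/ d).-1.+1 = (n.+1 %/ d)%N,
      (d * (n.+1 %/ d))%N = n.+1, (0 < d)%N & (0 < n.+1 %/ d)%N].
Proof.
move=> dn; have d0 := dvdn_gt0 (ltn0Sn n) dn.
have q0 : (0 < n.+1 %/ d)%N by rewrite divn_gt0 // dvdn_leq.
by split; rewrite ?prednK // mulnC divnK.
Qed.

Lemma uniq_product_fiber k : uniq (product_fiber k).
Proof.
rewrite map_inj_in_uniq ?divisors_uniq // => d e /divisor_gt0 d0 /divisor_gt0 e0.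
by case=> de _; rewrite -(prednK d0) -(prednK e0) de.
Qed.

Lemma mem_product_fiber k i j :
  ((i, j) \in product_fiber k) = ((i.+1 * j.+1).-1 == k).
Proof.
apply/mapP/eqP => [[d dk [-> ->]]|<-].
  by move: dk; rewrite -dvdn_divisors // => /divisor_pred[-> -> -> _ _].
exists i.+1; rewrite (@prednK (i.+1 * j.+1)) ?muln_gt0 //.
  by rewrite -dvdn_divisors ?dvdn_mulr.
by rewrite mulKn.
Qed.

Lemma uniq_diagonal_fiber m n : uniq (diagonal_fiber m n).
Proof.
have g0 : (0 < gcdn m.+1 n.+1)%N by rewrite gcdn_gt0.
rewrite map_inj_in_uniq ?divisors_uniq // => d e.
rewrite -(prednK g0) => /divisor_gt0 d0 /divisor_gt0 e0.
by case=> de _ _; rewrite -(prednK d0) -(prednK e0) de.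
Qed.

Lemma mem_diagonal_fiber m n d i j : ((d, (i, j)) \in diagonal_fiber m n) =
  (((d.+1 * i.+1).-1, (d.+1 * j.+1).-1)%N == (m, n)).
Proof.
have g0 : (0 < gcdn m.+1 n.+1)%N by rewrite gcdn_gt0.
apply/mapP/eqP => [[e]|[<- <-]].
  rewrite -dvdn_divisors // dvdn_gcd => /andP[em en] [-> -> ->].
  have [-> -> -> _ _] := divisor_pred em.
  by have [_ -> -> _ _] := divisor_pred en.
exists d.+1; rewrite (@prednK (d.+1 * i.+1)) ?(@prednK (d.+1 * j.+1)) ?muln_gt0 //.
  by rewrite -dvdn_divisors ?gcdn_gt0 ?muln_gt0 // dvdn_gcd !dvdn_mulr.
by rewrite !mulKn.
Qed.

Lemma uniq_pairwise_fiber m n : uniq (pairwise_fiber m n).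
Proof.
apply: allpairs_uniq; rewrite ?divisors_uniq // => -[a b] [c d].
move=> /allpairsP[[a' b'] /= [/divisor_gt0 a0 /divisor_gt0 b0 [-> ->]]].
move=> /allpairsP[[c' d'] /= [/divisor_gt0 c0 /divisor_gt0 d0 [-> ->]]].
case=> ac bd _ _.
by rewrite -(prednK a0) -(prednK b0) -(prednK c0) -(prednK d0) ac bd.
Qed.

Lemma mem_pairwise_fiber m n a b c d : (((a, b), (c, d)) \in pairwise_fiber m n) =
  (((a.+1 * c.+1).-1, (b.+1 * d.+1).-1)%N == (m, n)).
Proof.
apply/allpairsP/eqP => [[[i j] [im jn [-> -> -> ->]]]|[<- <-]].
  move: im jn; rewrite -!dvdn_divisors // => im jn.
  have [-> -> -> _ _] := divisor_pred im.
  by have [-> -> -> _ _] := divisor_pred jn.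
exists (a.+1, b.+1).
rewrite (@prednK (a.+1 * c.+1)) ?(@prednK (b.+1 * d.+1)) ?muln_gt0 //.
by rewrite -!dvdn_divisors ?muln_gt0 // !dvdn_mulr // !mulKn.
Qed.

Section dirichlet_series.
Variable R : realType.
Notation C := (CC R).
Implicit Types (s z w : R[i]) (a b : nat -> nat) (f g : nat -> nat -> nat).

Definition dirichlet_sum a s (l : C) : Prop :=
  abs_sum (fun k => (a k.+1)%:R / npowC k.+1 s : C) l.

Definition dirichlet_sum2 f z w (l : C) : Prop :=
  abs_sum (fun p => (f p.1.+1 p.2.+1)%:R / (npowC p.1.+1 z * npowC p.2.+1 w) : C) l.

Lemma dirichlet_sum_conv a b s l m :
  dirichlet_sum a s l -> dirichlet_sum b s m ->
  dirichlet_sum (fun n => \sum_(d <- divisors n) a d * b (n %/ d))%N s (l * m).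
Proof.
apply: (@abs_sum_convolution _ _ _ _ _ _ _ (fun p => (p.1.+1 * p.2.+1).-1)
  product_fiber).
- exact: uniq_product_fiber.
- by move=> k [i j]; apply: mem_product_fiber.
move=> k.
rewrite big_map natr_sum mulr_suml big_seq [RHS]big_seq; apply: eq_bigr => d.
rewrite -dvdn_divisors // => /divisor_pred[dE qE kE d0 q0] /=.
by rewrite dE qE mulrACA -invfM -npowCM // kE natrM.
Qed.

(** The series of [a] is taken at z + w because a common factor d of both indices contributes d ^ z
    d ^ w = d ^ (z + w). *)
Lemma dirichlet_sum_conv2 a f z w l m :
  dirichlet_sum a (z + w) l -> dirichlet_sum2 f z w m ->
  dirichlet_sum2 (fun i j =>
    \sum_(d <- divisors (gcdn i j)) a d * f (i %/ d) (j %/ d))%N z w (l * m).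
Proof.
apply: (@abs_sum_convolution _ _ _ _ _ _ _
  (fun q => ((q.1.+1 * q.2.1.+1).-1, (q.1.+1 * q.2.2.+1).-1)%N)
  (fun p => diagonal_fiber p.1 p.2)).
- by move=> p; apply: uniq_diagonal_fiber.
- by move=> [i' j'] [d [i j]]; apply: mem_diagonal_fiber.
move=> [i j].
rewrite big_map natr_sum mulr_suml big_seq [RHS]big_seq; apply: eq_bigr => d.
rewrite -dvdn_divisors ?gcdn_gt0 // dvdn_gcd => /andP[di dj] /=.
have [dE iE iM d0 i0] := divisor_pred di; have [_ jE jM _ j0] := divisor_pred dj.
rewrite dE iE jE mulrACA -invfM npowCD mulrACA.
by rewrite -(npowCM z d0 i0) -(npowCM w d0 j0) iM jM natrM.
Qed.

Lemma dirichlet_sum2_conv f g z w l m :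
  dirichlet_sum2 f z w l -> dirichlet_sum2 g z w m ->
  dirichlet_sum2 (fun i j => \sum_(a <- divisors i) \sum_(b <- divisors j)
    f a b * g (i %/ a) (j %/ b))%N z w (l * m).
Proof.
apply: (@abs_sum_convolution _ _ _ _ _ _ _
  (fun q => ((q.1.1.+1 * q.2.1.+1).-1, (q.1.2.+1 * q.2.2.+1).-1)%N)
  (fun p => pairwise_fiber p.1 p.2)).
- by move=> p; apply: uniq_pairwise_fiber.
- by move=> [i j] [[? ?] [? ?]]; apply: mem_pairwise_fiber.
move=> [i j].
rewrite big_allpairs_dep natr_sum mulr_suml big_seq [RHS]big_seq.
apply: eq_bigr => a.
rewrite -dvdn_divisors // => /divisor_pred[aE iE iM a0 i0] /=.
rewrite natr_sum mulr_suml big_seq [RHS]big_seq; apply: eq_bigr => b.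
rewrite -dvdn_divisors // => /divisor_pred[bE jE jM b0 j0] /=.
rewrite aE iE bE jE mulrACA -invfM mulrACA.
by rewrite -(npowCM z a0 i0) -(npowCM w b0 j0) iM jM natrM.
Qed.

Lemma eq_dirichlet_sum a b s l : (forall n, (0 < n)%N -> a n = b n) ->
  dirichlet_sum a s l -> dirichlet_sum b s l.
Proof.
move=> ab; rewrite /dirichlet_sum; congr (abs_sum _ l).
by apply/funext => k; rewrite ab.
Qed.

Lemma eq_dirichlet_sum2 f g z w l :
  (forall i j, (0 < i)%N -> (0 < j)%N -> f i j = g i j) ->
  dirichlet_sum2 f z w l -> dirichlet_sum2 g z w l.
Proof.
move=> fg; rewrite /dirichlet_sum2; congr (abs_sum _ l).
by apply/funext => p; rewrite fg.
Qed.

(** * The particular Dirichlet series *)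

Lemma dirichlet_sum1 s : 1 < complex.Re s -> dirichlet_sum (fun=> 1%N) s (zeta s).
Proof.
move=> /zeta_abs_sum; rewrite /dirichlet_sum; congr (abs_sum _ _).
by apply/funext => k; rewrite mul1r.
Qed.

Lemma dirichlet_sum2_1 z w : 1 < complex.Re z -> 1 < complex.Re w ->
  dirichlet_sum2 (fun _ _ => 1%N) z w (zeta z * zeta w).
Proof.
move=> hz hw; have := abs_sum_prod (zeta_abs_sum hz) (zeta_abs_sum hw).
rewrite /dirichlet_sum2; congr (abs_sum _ _).
by apply/funext => p; rewrite mul1r invfM.
Qed.

Lemma dirichlet_sum_id s : 2 < complex.Re s -> dirichlet_sum id s (zeta (s - 1)).
Proof.
move=> hs; have /zeta_abs_sum : 1 < complex.Re (s - 1).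
  by case: s hs => x y /= hs; lra.
rewrite /dirichlet_sum; congr (abs_sum _ _); apply/funext => k.
have -> : npowC k.+1 s = npowC k.+1 (s - 1) * k.+1%:R.
  by rewrite -[in LHS](subrK 1 s) (npowCD _ (s - 1) 1) npowC1.
rewrite invfM mulrCA mulfV ?mulr1 //.
Qed.

Lemma normc_nat n : normc (n%:R : R[i]) = n%:R.
Proof.
by rewrite -(rmorph_nat (real_complex R)) /= expr0n addr0 sqrtr_sqr normr_nat.
Qed.

(** Summability comes from comparison with the identity, as [totient n <= n]. The value then follows
    from the convolution of [totient] with 1, uniqueness of sums and division by [zeta s]. *)
Lemma dirichlet_sum_totient s : 2 < complex.Re s ->
  dirichlet_sum totient s (zeta (s - 1) / zeta s).
Proof.
move=> hs; have z0 := zeta_neq0 hs.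
have hs1 : 1 < complex.Re s by apply: lt_trans hs; rewrite ltr1n.
have [l lP] : exists l, dirichlet_sum totient s l.
  apply: abs_bounded_sum; have [+ _] := dirichlet_sum_id hs.
  apply: abs_bounded_le => k; rewrite !normcM !normc_nat ler_wpM2r ?normc_ge0 //.
  rewrite ler_nat -[leqRHS]sum_totient_divisors //.
  by rewrite (bigD1_seq k.+1) ?divisors_uniq ?divisors_id // leq_addr.
suff -> : zeta (s - 1) / zeta s = l by [].
apply/(mulIf z0); rewrite divfK //.
have [_ h1] := dirichlet_sum_id hs.
have [_ h2] : dirichlet_sum id s (l * zeta s).
  apply: eq_dirichlet_sum (dirichlet_sum_conv lP (dirichlet_sum1 hs1)) => n n0 /=.
  by under eq_bigr do rewrite muln1; apply: sum_totient_divisors.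
exact: has_sum_unique h1 h2.
Qed.

Lemma dirichlet_sum2_gcd z w : 1 < complex.Re z -> 1 < complex.Re w ->
  dirichlet_sum2 gcdn z w (zeta (z + w - 1) / zeta (z + w) * (zeta z * zeta w)).
Proof.
move=> hz hw; have hs : 2 < complex.Re (z + w).
  by case: z w hz hw => [x y] [u v] /= hz hw; lra.
have := dirichlet_sum_conv2 (dirichlet_sum_totient hs) (dirichlet_sum2_1 hz hw).
apply: eq_dirichlet_sum2 => i j i0 j0 /=; under eq_bigr do rewrite muln1.
by rewrite sum_totient_divisors // gcdn_gt0 i0.
Qed.

Lemma dirichlet_sum2_totient_gcd z w : 1 < complex.Re z -> 1 < complex.Re w ->
  dirichlet_sum2 (fun i j => totient (gcdn i j)) z w
    (zeta (z + w - 1) / zeta (z + w) * (zeta z * zeta w) / zeta (z + w)).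
Proof.
move=> hz hw; have hs : 2 < complex.Re (z + w).
  by case: z w hz hw => [x y] [u v] /= hz hw; lra.
have z0 := zeta_neq0 hs.
have hs1 : 1 < complex.Re (z + w) by apply: lt_trans hs; rewrite ltr1n.
have gP := dirichlet_sum2_gcd hz hw.
have [l lP] : exists l, dirichlet_sum2 (fun i j => totient (gcdn i j)) z w l.
  apply: abs_bounded_sum; have [+ _] := gP.
  apply: abs_bounded_le => p; rewrite !normcM !normc_nat ler_wpM2r ?normc_ge0 //.
  have g0 : (0 < gcdn p.1.+1 p.2.+1)%N by rewrite gcdn_gt0.
  rewrite ler_nat -[leqRHS]sum_totient_divisors //.
  by rewrite (bigD1_seq (gcdn p.1.+1 p.2.+1)) ?divisors_uniq ?divisors_id // leq_addr.
(* Convolving the constant 1 with the unknown sum [l] gives the gcd series again, so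
   [zeta (z + w) * l = G]. *)
set G := zeta (z + w - 1) / _ * _ in gP *.
suff -> : G / zeta (z + w) = l by [].
apply/(mulIf z0); rewrite divfK // mulrC.
have [_ h1] := gP.
have [_ h2] : dirichlet_sum2 gcdn z w (zeta (z + w) * l).
  have := dirichlet_sum_conv2 (dirichlet_sum1 hs1) lP.
  apply: eq_dirichlet_sum2 => i j i0 j0 /=.
  have g0 : (0 < gcdn i j)%N by rewrite gcdn_gt0 i0.
  (* The divisor sum of the gcd is reversed to match [gcdn (i %/ d) (j %/ d) = gcdn i j %/ d]. *)
  rewrite -[RHS]sum_totient_divisors // -[RHS]big_divisors_inv //.
  rewrite big_seq [RHS]big_seq; apply: eq_bigr => d.
  rewrite -dvdn_divisors // dvdn_gcd => /andP[di dj]; rewrite mul1n; congr totient.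
  have d0 := dvdn_gt0 i0 di.
  by apply/eqP; rewrite -(eqn_pmul2r d0) muln_gcdl !divnK // dvdn_gcd di.
exact: has_sum_unique h1 h2.
Qed.

End dirichlet_series.

Theorem theorem1 (R : realType) (z w : R[i])
    (hz : 1 < complex.Re z) (hw : 1 < complex.Re w) :
  double_series_cvg
    (fun m n => (nb_subgroups m n)%:R / (npowC m z * npowC n w))
    (zeta z ^+ 2 * zeta w ^+ 2 * zeta (z + w - 1) / zeta (z + w))
  /\
  double_series_cvg
    (fun m n => (nb_cyclic_subgroups m n)%:R / (npowC m z * npowC n w))
    (zeta z ^+ 2 * zeta w ^+ 2 * zeta (z + w - 1) / zeta (z + w) ^+ 2).
Proof.
have hs : 2 < complex.Re (z + w).
  by case: z w hz hw => [x y] [u v] /= hz hw; lra.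
have z0 := zeta_neq0 hs; have oneP := dirichlet_sum2_1 hz hw; split.
  (* Summing over all a | m and b | n is a pairwise convolution with 1, whence the extra factor
     [zeta z * zeta w]. *)
  have [_] : dirichlet_sum2 nb_subgroups z w
      (zeta (z + w - 1) / zeta (z + w) * (zeta z * zeta w) * (zeta z * zeta w)).
    apply: eq_dirichlet_sum2 (dirichlet_sum2_conv (dirichlet_sum2_gcd hz hw) oneP).
    case=> [|m] [|n] // _ _; rewrite card_subgroups.
    by apply: eq_bigr => a _; apply: eq_bigr => b _; rewrite muln1.
  by congr (has_sum _ _); field.
have [_] : dirichlet_sum2 nb_cyclic_subgroups z w
    (zeta (z + w - 1) / zeta (z + w) * (zeta z * zeta w) / zeta (z + w)
      * (zeta z * zeta w)).
  have := dirichlet_sum2_conv (dirichlet_sum2_totient_gcd hz hw) oneP.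
  apply: eq_dirichlet_sum2 => m n m0 n0; rewrite card_cyclic_subgroups //.
  by apply: eq_bigr => a _; apply: eq_bigr => b _; rewrite muln1.
by congr (has_sum _ _); field.
Qed.
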